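(* Let $a\in\mathbb{R}\setminus\{0\}$, $T>0$, and let $\gamma\in\mathcal{C}_T$ be an extremal curve of the functional $\mathcal{B}_a(\gamma)=\int_0^T p(t)^a\,dt$ on $\mathcal{C}_T$. If $a\neq 1$, then $F:=p^{a-1}$ satisfies $$F'''=-2(2+b)F^{b}F',\qquad b=\frac{1}{a-1}.$$ If $a=1$ or $a=\tfrac12$, then $p$ is constant, and $\gamma$ is therefore a conic.
   Context: $[\cdot,\cdot]$ denotes the determinant of two vectors in $\mathbb{R}^2$. $\mathcal{C}_T$ is the space of smooth $T$-periodic curves $\gamma:\mathbb{R}\to\mathbb{R}^2$ in centroaffine parameterization, i.e. $[\gamma,\gamma']=1$, with positive centroaffine curvature $p:=[\gamma',\gamma'']>0$; then $\gamma''=-p\gamma$. The infinitesimal deformations of $\gamma$ preserving the condition $[\gamma,\gamma']=1$ are the vector fields $v_f=-\tfrac{f'}{2}\gamma+f\gamma'$ with $f$ a smooth $T$-periodic function. A curve $\gamma\in\mathcal{C}_T$ is extremal (critical) for $\mathcal{B}_a$ if $\frac{d}{d\varepsilon}\big|_{\varepsilon=0}\int_0^T[(\gamma+\varepsilon v_f)',(\gamma+\varepsilon v_f)'']^a\,dt=0$ for every smooth $T$-periodic $f$. *)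

(* Defs.v *)
From Stdlib Require Import Reals.
From Coquelicot Require Import Coquelicot.
Open Scope R_scope.

Definition smooth (f : R -> R) : Prop := forall n x, ex_derive_n f n x.

Definition periodic {A : Type} (T : R) (g : R -> A) : Prop :=
  forall t, g (t + T) = g t.

Definition plane_curve : Type := R -> R * R.

Definition smooth_curve (g : plane_curve) : Prop :=
  smooth (fun t => fst (g t)) /\ smooth (fun t => snd (g t)).

Definition det2 (u v : R * R) : R := fst u * snd v - snd u * fst v.

Definition vadd (u v : R * R) : R * R := (fst u + fst v, snd u + snd v).

Definition vscale (c : R) (u : R * R) : R * R := (c * fst u, c * snd u).

Definition Dcurve (g : plane_curve) : plane_curve :=
  fun t => (Derive (fun s => fst (g s)) t, Derive (fun s => snd (g s)) t).

Definition curvature (g : plane_curve) : R -> R :=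
  fun t => det2 (Dcurve g t) (Dcurve (Dcurve g) t).

(* The space C_T; T is a period, not necessarily the least one. *)
Definition in_CT (T : R) (g : plane_curve) : Prop :=
  smooth_curve g /\ periodic T g /\
  (forall t, det2 (g t) (Dcurve g t) = 1) /\
  (forall t, 0 < curvature g t).

Definition deformation (g : plane_curve) (f : R -> R) : plane_curve :=
  fun t => vadd (vscale (- (Derive f t / 2)) (g t)) (vscale (f t) (Dcurve g t)).

Definition perturb (g v : plane_curve) (eps : R) : plane_curve :=
  fun t => vadd (g t) (vscale eps (v t)).

(* [Rpower x a] is the real power only for x > 0.  This holds for curves in
   C_T and, by compactness of a period, for their perturbations with eps close
   to 0, which is all that the derivative at eps = 0 below depends on. *)
Definition Bfun (a T : R) (g : plane_curve) : R :=
  RInt (fun t => Rpower (curvature g t) a) 0 T.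

Definition extremal (a T : R) (g : plane_curve) : Prop :=
  in_CT T g /\
  forall f : R -> R, smooth f -> periodic T f ->
    is_derive (fun eps => Bfun a T (perturb g (deformation g f) eps)) 0 0.

(* The inequation is the nonvanishing of the determinant of the symmetric
   matrix ((A, B, D), (B, C, E), (D, E, F)), i.e. nondegeneracy. *)
Definition is_conic (S : R * R -> Prop) : Prop :=
  exists A B C D E F : R,
    A * (C * F - E * E) - B * (B * F - D * E) + D * (B * E - C * D) <> 0 /\
    forall x y : R,
      S (x, y) <->
      A * x ^ 2 + 2 * B * x * y + C * y ^ 2 + 2 * D * x + 2 * E * y + F = 0.

Definition trace (g : plane_curve) : R * R -> Prop :=
  fun q => exists t, g t = q.

(* Main.v *)
(** Since [g'' = - p g], deforming [g] along [v_f] changes the curvature to first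
    order by [f'''/2 + p' f + 2 p f'].  Differentiating under the integral sign
    and integrating by parts, extremality says that
    [G := F'''/2 + F p' + 2 p F'], with [F := p^(a-1)], is orthogonal to every
    smooth [T]-periodic [f]; the choice [f := G] gives [G = 0].  For [a <> 1] we
    have [p = F^b] and [F p' = b p F'], which turns [G = 0] into the stated
    equation.  For [a = 1] it reads [p' = 0]; for [a = 1/2] it reads [F''' = 0],
    so the periodic function [F] is constant.  A curve of constant curvature
    solves a harmonic oscillator equation and traces an ellipse. *)

Require Import Defs.
From Stdlib Require Import Reals Lra FunctionalExtensionality.
From Coquelicot Require Import Coquelicot.
Open Scope R_scope.

(** * Real powers and continuity *)

Lemma is_derive_Rpower (c : R) (f : R -> R) (t df : R) :
  0 < f t -> is_derive f t df ->
  is_derive (fun s => Rpower (f s) c) t (c * Rpower (f t) (c - 1) * df).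
Proof.
  intros hf hd.
  replace (c * Rpower (f t) (c - 1) * df)
    with (scal df (c * Rpower (f t) (c - 1)))
    by (unfold scal; simpl; unfold mult; simpl; ring).
  apply (is_derive_comp (fun y => Rpower y c) f); [ | exact hd].
  apply is_derive_Reals, derivable_pt_lim_power, hf.
Qed.

Lemma Rpower_pred_mult (x c : R) : 0 < x -> Rpower x (c - 1) * x = Rpower x c.
Proof.
  intros hx. rewrite <- (Rpower_1 x hx) at 2. rewrite <- Rpower_plus.
  f_equal; ring.
Qed.

Lemma ex_derive_continuity_pt (f : R -> R) (t : R) :
  ex_derive f t -> continuity_pt f t.
Proof.
  intros h. apply continuity_pt_filterlim. exact (ex_derive_continuous f t h).
Qed.

Lemma continuous_continuity_pt (f : R -> R) (t : R) :
  continuous f t -> continuity_pt f t.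
Proof. intros h. apply continuity_pt_filterlim. exact h. Qed.

(** * Smooth functions *)

Lemma smooth_ex_derive (f : R -> R) : smooth f -> forall t, ex_derive f t.
Proof. intros h t. exact (h 1%nat t). Qed.

Lemma smooth_is_derive (f : R -> R) (t : R) :
  smooth f -> is_derive f t (Derive f t).
Proof. intros h. apply Derive_correct, smooth_ex_derive, h. Qed.

Lemma smooth_continuous (f : R -> R) (t : R) : smooth f -> continuous f t.
Proof.
  intros h. apply (ex_derive_continuous f t), smooth_ex_derive, h.
Qed.

Lemma Derive_n_Derive (f : R -> R) (n : nat) :
  Derive_n (Derive f) n = Derive_n f (S n).
Proof.
  apply functional_extensionality; intros t.
  change (Derive f) with (Derive_n f 1).
  rewrite Derive_n_comp. f_equal. rewrite PeanoNat.Nat.add_1_r; reflexivity.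
Qed.

Lemma smooth_Derive (f : R -> R) : smooth f -> smooth (Derive f).
Proof.
  intros h [ | n] t; [exact I | ].
  generalize (h (S (S n)) t); simpl ex_derive_n.
  rewrite Derive_n_Derive; auto.
Qed.

(** A class of differentiable functions that is stable under [Derive] contains every iterated
    derivative of its members, so each of these is again differentiable. *)
Lemma smooth_coind (P : (R -> R) -> Prop) :
  (forall f, P f -> (forall t, ex_derive f t) /\ P (Derive f)) ->
  forall f, P f -> smooth f.
Proof.
  intros hP f hf.
  assert (hn : forall n, P (Derive_n f n)).
  { induction n as [ | n IH]; [exact hf | apply hP, IH]. }
  intros [ | n] t; [exact I | apply hP, hn].
Qed.

(* Closed under differentiation, so [smooth_coind] gives smoothness of all the
   expressions at once, without a Leibniz formula for higher derivatives. *)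
Inductive smooth_expr : (R -> R) -> Prop :=
| se_base f : smooth f -> smooth_expr f
| se_plus f g : smooth_expr f -> smooth_expr g ->
    smooth_expr (fun t => f t + g t)
| se_mult f g : smooth_expr f -> smooth_expr g ->
    smooth_expr (fun t => f t * g t)
| se_power c f : smooth f -> (forall t, 0 < f t) ->
    smooth_expr (fun t => Rpower (f t) c).

Lemma smooth_const (c : R) : smooth (fun _ => c).
Proof. intros n t. apply ex_derive_n_const. Qed.

Lemma smooth_expr_smooth (f : R -> R) : smooth_expr f -> smooth f.
Proof.
  apply smooth_coind; clear f; intros f hf.
  induction hf as [f hf | f g hf [IHf IHf'] hg [IHg IHg']
                  | f g hf [IHf IHf'] hg [IHg IHg'] | c f hf hpos].
  - split; [apply smooth_ex_derive, hf | apply se_base, smooth_Derive, hf].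
  - split.
    + intros t. apply (ex_derive_plus f g); auto.
    + replace (Derive (fun t => f t + g t))
        with (fun t => Derive f t + Derive g t); [apply se_plus; auto | ].
      apply functional_extensionality; intros t.
      rewrite Derive_plus; auto.
  - split.
    + intros t. apply (ex_derive_mult f g); auto.
    + replace (Derive (fun t => f t * g t))
        with (fun t => Derive f t * g t + f t * Derive g t);
        [apply se_plus; apply se_mult; auto | ].
      apply functional_extensionality; intros t.
      rewrite Derive_mult; auto.
  - assert (h : forall t, is_derive (fun s => Rpower (f s) c) t
                  (c * Rpower (f t) (c - 1) * Derive f t)).
    { intros t. apply is_derive_Rpower; [auto | apply smooth_is_derive, hf]. }
    split; [intros t; eexists; apply h | ].
    (* The exponent drops to [c - 1], which is harmless because [se_power] admits every real
       exponent; this is what keeps the class closed. *)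
    replace (Derive (fun s => Rpower (f s) c))
      with (fun t => c * Rpower (f t) (c - 1) * Derive f t).
    + apply (se_mult (fun t => c * Rpower (f t) (c - 1)));
        [apply (se_mult (fun _ => c)) | ].
      * apply se_base, smooth_const.
      * apply se_power; auto.
      * apply se_base, smooth_Derive, hf.
    + apply functional_extensionality; intros t.
      symmetry; apply is_derive_unique, h.
Qed.

Lemma smooth_plus (f g : R -> R) :
  smooth f -> smooth g -> smooth (fun t => f t + g t).
Proof. intros; apply smooth_expr_smooth, se_plus; apply se_base; auto. Qed.

Lemma smooth_mult (f g : R -> R) :
  smooth f -> smooth g -> smooth (fun t => f t * g t).
Proof. intros; apply smooth_expr_smooth, se_mult; apply se_base; auto. Qed.

Lemma smooth_scal (c : R) (f : R -> R) : smooth f -> smooth (fun t => c * f t).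
Proof. apply (smooth_mult (fun _ => c)), smooth_const. Qed.

Lemma smooth_minus (f g : R -> R) :
  smooth f -> smooth g -> smooth (fun t => f t - g t).
Proof.
  intros hf hg.
  replace (fun t => f t - g t) with (fun t => f t + -1 * g t)
    by (apply functional_extensionality; intros; ring).
  apply smooth_plus, smooth_scal; auto.
Qed.

Lemma smooth_Rpower (c : R) (f : R -> R) :
  smooth f -> (forall t, 0 < f t) -> smooth (fun t => Rpower (f t) c).
Proof. intros; apply smooth_expr_smooth, se_power; auto. Qed.

(* Dispatches on the syntax of the function: unification alone would unfold
   [Derive] in search of a sum or a product. *)
Ltac prove_smooth :=
  repeat (assumption ||
    lazymatch goal with
    | |- smooth (fun _ => ?c) => apply smooth_const
    | |- smooth (fun t => @?f t + @?g t) => apply (smooth_plus f g)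
    | |- smooth (fun t => @?f t - @?g t) => apply (smooth_minus f g)
    | |- smooth (fun t => @?f t * @?g t) => apply (smooth_mult f g)
    | |- smooth (fun t => Derive ?f t) => apply (smooth_Derive f)
    | |- smooth (Derive ?f) => apply (smooth_Derive f)
    end).

(** * Periodic functions *)

(** The difference quotients at [t] and [t + T] are equal term by term, hence so are their limits in
    the total sense of [Lim]. *)
Lemma periodic_Derive (T : R) (f : R -> R) :
  periodic T f -> periodic T (Derive f).
Proof.
  intros h t. unfold Derive. f_equal. apply Lim_ext; intros e.
  rewrite <- (h t), <- (h (t + e)).
  replace (t + e + T) with (t + T + e) by ring. reflexivity.
Qed.

Lemma Derive_zero_const (f : R -> R) :
  (forall t, is_derive f t 0) -> forall s t, f s = f t.
Proof.
  intros h s t. destruct (Rtotal_order s t) as [lt | [-> | lt]]; auto.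
  - apply eq_is_derive; auto.
  - symmetry; apply eq_is_derive; auto.
Qed.

(** The function [f t - c * t] is constant, and comparing its values at [0] and [T] gives
    [c * T = 0]. Applied to successive derivatives, this integrates [F''' = 0] for periodic [F]. *)
Lemma periodic_Derive_const (T c : R) (f : R -> R) :
  0 < T -> periodic T f -> (forall t, is_derive f t c) -> c = 0.
Proof.
  intros hT hp hd.
  assert (hconst := Derive_zero_const (fun t => f t - c * t)).
  assert (hz : forall t, is_derive (fun t => f t - c * t) t 0).
  { intros t. replace 0 with (minus c (c * 1)) by
      (unfold minus, plus, opp; simpl; ring).
    apply (is_derive_minus f (fun t => c * t)); [apply hd | ].
    auto_derive; auto. }
  specialize (hconst hz T 0). simpl in hconst.
  generalize (hp 0); rewrite Rplus_0_l; intros e. rewrite e in hconst. nra.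
Qed.

Lemma monotone_of_Derive_nonneg (f df : R -> R) :
  (forall t, is_derive f t (df t)) -> (forall t, 0 <= df t) ->
  forall s t, s <= t -> f s <= f t.
Proof.
  intros hd hpos s t hst.
  destruct (MVT_gen f s t df) as [c [_ hc]].
  - intros; apply hd.
  - intros x _; apply ex_derive_continuity_pt; eexists; apply hd.
  - generalize (hpos c); nra.
Qed.

(* The primitive of [h] is monotone and, having zero mean, periodic. *)
Lemma periodic_nonneg_RInt_zero (T : R) (h : R -> R) :
  0 < T -> periodic T h -> (forall t, continuous h t) ->
  (forall t, 0 <= h t) -> RInt h 0 T = 0 -> forall t, h t = 0.
Proof.
  intros hT hper hcont hpos hint t.
  set (K := fun s => RInt h 0 s).
  assert (hK : forall s, is_derive K s (h s)).
  { intros s. apply (is_derive_RInt h K 0 s); [ | apply hcont].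
    apply filter_forall; intros u. apply (@RInt_correct R_CompleteNormedModule).
    apply (@ex_RInt_continuous R_CompleteNormedModule); intros; apply hcont. }
  assert (hmono := monotone_of_Derive_nonneg K h hK hpos).
  assert (hKper : forall s, K (s + T) = K s).
  { intros s.
    assert (e : forall u, is_derive (fun u => K (u + T) - K u) u 0).
    { intros u. replace 0 with (minus (scal 1 (h (u + T))) (h u)).
      - apply (is_derive_minus (fun u => K (u + T)) K); [ | apply hK].
        apply (is_derive_comp K (fun u => u + T)); [apply hK | ].
        auto_derive; auto.
      - rewrite hper. unfold minus, plus, opp, scal; simpl.
        unfold mult; simpl; ring. }
    generalize (Derive_zero_const _ e s 0); cbv beta.
    rewrite Rplus_0_l. unfold K at 3 4. rewrite hint, RInt_point.
    intros d0; change (K (s + T) - K s = 0 - 0) in d0; lra. }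
  (* [K] takes the same value at [t - T / 2] and [t + T / 2], so by monotonicity it is constant in
     between and its derivative [h t] vanishes. *)
  assert (hloc : locally t (fun s => K (t - T / 2) = K s)).
  { exists (mkposreal (T / 2) ltac:(lra)); intros s hs.
    apply Rabs_lt_between' in hs; simpl in hs.
    apply Rle_antisym; [apply hmono; lra | ].
    rewrite <- (hKper (t - T / 2)). apply hmono; lra. }
  rewrite <- (is_derive_unique K t (h t)) by apply hK.
  rewrite <- (Derive_ext_loc (fun _ => K (t - T / 2)) K t hloc).
  apply Derive_const.
Qed.

(** * Differentiating the energy under the integral sign *)

(** By compactness [p] has a positive minimum [m] and [|q| + |r|] a maximum [M] on the period. For
    [|e| < 1] the perturbation is at most [|e| * M], which is below [m] for small [e], uniformly in
    [t]. This keeps the base of [Rpower] positive. *)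
Lemma quadratic_perturbation_pos (T : R) (p q r : R -> R) :
  0 <= T ->
  (forall t, continuous p t) -> (forall t, continuous q t) ->
  (forall t, continuous r t) -> (forall t, 0 < p t) ->
  exists d : posreal, forall e, Rabs e < d ->
    forall t, 0 <= t <= T -> 0 < p t + e * q t + e ^ 2 * r t.
Proof.
  intros hT hp hq hr hpos.
  destruct (continuity_ab_min p 0 T hT) as [tm [hm _]].
  { intros; apply continuous_continuity_pt, hp. }
  destruct (continuity_ab_maj (fun t => Rabs (q t) + Rabs (r t)) 0 T hT)
    as [tM [hM _]].
  { intros; apply continuous_continuity_pt.
    apply (continuous_plus (fun t => Rabs (q t)) (fun t => Rabs (r t)));
      apply continuous_comp; auto using continuous_Rabs. }
  set (m := p tm) in *. set (M := Rabs (q tM) + Rabs (r tM)) in *.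
  assert (m_pos : 0 < m) by apply hpos.
  assert (M_pos : 0 <= M)
    by (unfold M; generalize (Rabs_pos (q tM)) (Rabs_pos (r tM)); lra).
  (* The bound [1] gives [e ^ 2 <= |e|]; the denominator [M + 1] stays positive when [M = 0]. *)
  assert (d_pos : 0 < Rmin 1 (m / (M + 1))).
  { apply Rmin_pos; [lra | apply Rdiv_lt_0_compat; lra]. }
  exists (mkposreal _ d_pos); simpl; intros e he t ht.
  assert (e1 : Rabs e < 1) by (eapply Rlt_le_trans; [exact he | apply Rmin_l]).
  assert (e2 : Rabs e < m / (M + 1))
    by (eapply Rlt_le_trans; [exact he | apply Rmin_r]).
  apply Rlt_div_r in e2; [ | lra].
  specialize (hm t ht); specialize (hM t ht); cbv beta in hM; fold M in hM.
  assert (b1 : Rabs (e * q t) <= Rabs e * Rabs (q t)) by (rewrite Rabs_mult; lra).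
  assert (b2 : Rabs (e ^ 2 * r t) <= Rabs e * Rabs (r t)).
  { rewrite Rabs_mult. apply Rmult_le_compat_r; [apply Rabs_pos | ].
    simpl; rewrite Rmult_1_r, Rabs_mult. generalize (Rabs_pos e); nra. }
  assert (b3 : Rabs e * (Rabs (q t) + Rabs (r t)) <= Rabs e * M)
    by (apply Rmult_le_compat_l; [apply Rabs_pos | auto]).
  apply Rabs_le_between in b1; apply Rabs_le_between in b2.
  generalize (Rabs_pos e); lra.
Qed.

(** The base is quadratic in [e] because the curvature of a perturbed curve is exactly so. The
    coefficient [r] enters the derivative only through [2 * e * r t], which vanishes at [e = 0]. *)
Lemma is_derive_RInt_Rpower (a T : R) (p q r : R -> R) :
  0 <= T ->
  (forall t, continuous p t) -> (forall t, continuous q t) ->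
  (forall t, continuous r t) -> (forall t, 0 < p t) ->
  is_derive (fun e => RInt (fun t => Rpower (p t + e * q t + e ^ 2 * r t) a) 0 T)
    0 (RInt (fun t => a * Rpower (p t) (a - 1) * q t) 0 T).
Proof.
  intros hT hp hq hr hpos.
  destruct (quadratic_perturbation_pos T p q r) as [d hd]; auto.
  set (P := fun e t => p t + e * q t + e ^ 2 * r t).
  assert (dP : forall e t, 0 < P e t -> is_derive (fun e => Rpower (P e t) a) e
                (a * Rpower (P e t) (a - 1) * (q t + 2 * e * r t))).
  { intros e t h. apply (is_derive_Rpower a (fun e => P e t)); [exact h | ].
    unfold P. auto_derive; [auto | ring]. }
  assert (c2 : forall f, (forall t, continuous f t) ->
            forall e t, continuity_2d_pt (fun _ v => f v) e t).
  { intros f hf e t. apply (continuity_1d_2d_pt_comp f (fun _ v => v)).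
    - apply continuous_continuity_pt, hf.
    - apply continuity_2d_pt_id2. }
  assert (ball0 : forall e, ball 0 d e -> Rabs e < d).
  { intros e he. apply Rabs_lt_between' in he. apply Rabs_lt_between. lra. }
  assert (cP : forall e t, continuity_2d_pt P e t).
  { intros e t. unfold P. apply continuity_2d_pt_plus.
    - apply continuity_2d_pt_plus; [auto | apply continuity_2d_pt_mult; auto].
      apply continuity_2d_pt_id1.
    - apply continuity_2d_pt_mult; [ | auto]. simpl.
      repeat apply continuity_2d_pt_mult;
        auto using continuity_2d_pt_id1, continuity_2d_pt_const. }
  assert (P0 : forall t, P 0 t = p t) by (intros; unfold P; ring).
  replace (RInt (fun t => a * Rpower (p t) (a - 1) * q t) 0 T)
    with (RInt (fun t => Derive (fun e => Rpower (P e t) a) 0) 0 T).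
  2: { apply RInt_ext; intros t _. apply is_derive_unique.
       generalize (dP 0 t); rewrite P0.
       replace (q t + 2 * 0 * r t) with (q t) by ring. auto. }
  apply (is_derive_RInt_param (fun e t => Rpower (P e t) a));
    rewrite ?Rmin_left, ?Rmax_right by lra.
  - exists d; intros e he t ht. eexists; apply dP, hd; auto.
  - intros t _.
    apply continuity_2d_pt_ext_loc with
      (fun e t => a * Rpower (P e t) (a - 1) * (q t + 2 * e * r t)).
    (* The derivative formula [dP] requires a positive base; continuity of [P] at [(0, t)] keeps the
       base above [p t / 2] nearby. *)
    + assert (hp2 : 0 < p t / 2) by (generalize (hpos t); lra).
      apply (locally_2d_impl_strong (fun e s => Rabs (P e s - P 0 t) < p t / 2));
        [ | exact (cP 0 t (mkposreal _ hp2))].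
      apply locally_2d_forall; intros e s h. apply locally_2d_singleton in h.
      symmetry; apply is_derive_unique, dP.
      rewrite P0 in h. apply Rabs_lt_between' in h. lra.
    + repeat apply continuity_2d_pt_mult; auto using continuity_2d_pt_const.
      * apply (continuity_1d_2d_pt_comp (fun y => Rpower y (a - 1))); auto.
        rewrite P0. apply ex_derive_continuity_pt.
        eexists; apply is_derive_Rpower; [apply hpos | apply is_derive_id].
      * apply continuity_2d_pt_plus; auto.
        repeat apply continuity_2d_pt_mult;
          auto using continuity_2d_pt_id1, continuity_2d_pt_const.
  - exists d; intros e he.
    apply (@ex_RInt_continuous R_CompleteNormedModule);
      rewrite Rmin_left, Rmax_right by lra; intros t ht.
    apply (continuous_comp (fun t => P e t) (fun y => Rpower y a)).
    + apply (continuous_plus (fun t => p t + e * q t)).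
      * apply (continuous_plus p); auto. apply (continuous_scal_r e q); auto.
      * apply (continuous_scal_r (e ^ 2) r); auto.
    + apply (ex_derive_continuous (fun y => Rpower y a)).
      eexists; apply is_derive_Rpower; [ | apply is_derive_id].
      apply hd; auto.
Qed.

(** * First variation of the centroaffine curvature *)

Lemma is_derive_eq (f : R -> R) (t l l' : R) :
  is_derive f t l -> l = l' -> is_derive f t l'.
Proof. intros h <-; exact h. Qed.

Lemma smooth_curvature (g : plane_curve) :
  smooth_curve g -> smooth (curvature g).
Proof.
  intros [hx hy].
  unfold curvature, det2, Dcurve; simpl. prove_smooth.
Qed.

Lemma periodic_curvature (T : R) (g : plane_curve) :
  periodic T g -> periodic T (curvature g).
Proof.
  intros h.
  assert (hx : periodic T (fun t => fst (g t))) by (intros t; now rewrite h).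
  assert (hy : periodic T (fun t => snd (g t))) by (intros t; now rewrite h).
  intros t. unfold curvature, det2, Dcurve; simpl.
  rewrite (periodic_Derive T _ hx), (periodic_Derive T _ hy).
  rewrite (periodic_Derive T _ (periodic_Derive T _ hx)).
  rewrite (periodic_Derive T _ (periodic_Derive T _ hy)). reflexivity.
Qed.

(** Differentiating [[g, g'] = 1] gives [[g, g''] = 0], so [g''] is a multiple of [g]; pairing with
    [g'] identifies the factor as minus the curvature. *)
Lemma centroaffine_ode (g : plane_curve) :
  smooth_curve g -> (forall t, det2 (g t) (Dcurve g t) = 1) ->
  forall t,
    Derive (Derive (fun s => fst (g s))) t = - curvature g t * fst (g t) /\
    Derive (Derive (fun s => snd (g s))) t = - curvature g t * snd (g t).
Proof.
  intros [hx hy] hdet t.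
  assert (e := hdet t).
  unfold curvature, det2, Dcurve in *; simpl in *.
  set (x := fun s => fst (g s)) in *. set (y := fun s => snd (g s)) in *.
  change (fst (g t)) with (x t) in *. change (snd (g t)) with (y t) in *.
  assert (h : x t * Derive (Derive y) t - y t * Derive (Derive x) t = 0).
  { rewrite <- (Derive_const 1 t).
    rewrite <- (Derive_ext (fun s => x s * Derive y s - y s * Derive x s)
                  (fun _ => 1) t hdet).
    symmetry; apply is_derive_unique.
    assert (hx1 := smooth_Derive _ hx). assert (hy1 := smooth_Derive _ hy).
    eapply is_derive_eq.
    - apply (is_derive_minus (fun s => x s * Derive y s)
               (fun s => y s * Derive x s));
        apply (is_derive_mult _ _ t); try apply smooth_is_derive;
        auto using Rmult_comm.
    - unfold minus, plus, opp, mult; simpl. ring. }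
  change (Derive (fun s => Derive x s) t) with (Derive (Derive x) t).
  change (Derive (fun s => Derive y s) t) with (Derive (Derive y) t).
  generalize dependent (Derive (Derive x) t).
  generalize dependent (Derive (Derive y) t).
  intros y2 x2 h. split.
  (* Multiply by [[g, g'] = 1] and subtract a multiple of [[g, g''] = 0]; what remains is [-
     [g', g'']] times the coordinate. *)
  - replace x2 with (x2 * (x t * Derive y t - y t * Derive x t)) at 1
      by (rewrite e; ring).
    replace (x2 * (x t * Derive y t - y t * Derive x t)) with
      (x2 * (x t * Derive y t - y t * Derive x t)
       - Derive x t * (x t * y2 - y t * x2)) by (rewrite h; ring).
    ring.
  - replace y2 with (y2 * (x t * Derive y t - y t * Derive x t)) at 1
      by (rewrite e; ring).
    replace (y2 * (x t * Derive y t - y t * Derive x t)) with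
      (y2 * (x t * Derive y t - y t * Derive x t)
       - Derive y t * (x t * y2 - y t * x2)) by (rewrite h; ring).
    ring.
Qed.

(** Here [x] stands for either coordinate of the curve. Eliminating [x''] by the equation expresses
    both derivatives of the perturbed coordinate through [x] and [x'], with coefficients common to
    the two coordinates. *)
Lemma Derive_perturb (p x f : R -> R) (e : R) :
  smooth p -> smooth x -> smooth f ->
  (forall t, Derive (Derive x) t = - p t * x t) ->
  let w := fun t => x t + e * (- (Derive f t / 2) * x t + f t * Derive x t) in
  (forall t, Derive w t =
     e * (- Derive (Derive f) t / 2 - p t * f t) * x t
     + (1 + e * (Derive f t / 2)) * Derive x t) /\
  (forall t, Derive (Derive w) t =
     (- p t + e * (- Derive (Derive (Derive f)) t / 2 - Derive p t * f t
                   - 3 / 2 * p t * Derive f t)) * x t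
     - e * p t * f t * Derive x t).
Proof.
  intros hp hx hf hode w.
  assert (hx' := smooth_ex_derive _ hx).
  assert (hp' := smooth_ex_derive _ hp).
  assert (hf' := smooth_ex_derive _ hf).
  assert (hx1' := smooth_ex_derive _ (smooth_Derive _ hx)).
  assert (hf1' := smooth_ex_derive _ (smooth_Derive _ hf)).
  assert (hf2' := smooth_ex_derive _ (smooth_Derive _ (smooth_Derive _ hf))).
  assert (h1 : forall t, Derive w t =
     e * (- Derive (Derive f) t / 2 - p t * f t) * x t
     + (1 + e * (Derive f t / 2)) * Derive x t).
  { intros t. apply is_derive_unique. unfold w.
    set (x1 := Derive x) in *; set (f1 := Derive f) in *.
    auto_derive; [repeat split; auto | ].
    change (Derive (fun t => x t) t) with (x1 t).
    change (Derive (fun t => f t) t) with (f1 t).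
    change (Derive (fun t => x1 t) t) with (Derive x1 t).
    change (Derive (fun t => f1 t) t) with (Derive f1 t).
    rewrite hode. field. }
  split; [exact h1 | ]. intros t.
  rewrite (Derive_ext _ _ t h1). apply is_derive_unique.
  set (x1 := Derive x) in *; set (f1 := Derive f) in *.
  set (f2 := Derive f1) in *.
  auto_derive; [repeat split; auto | ].
  change (Derive (fun t => x t) t) with (x1 t).
  change (Derive (fun t => f t) t) with (f1 t).
  change (Derive (fun t => p t) t) with (Derive p t).
  change (Derive (fun t => x1 t) t) with (Derive x1 t).
  change (Derive (fun t => f1 t) t) with (f2 t).
  change (Derive (fun t => f2 t) t) with (Derive f2 t).
  rewrite hode. field.
Qed.

(** In the frame [g, g'], which has determinant one, the first two derivatives of the perturbed
    curve have coefficients affine in [e]. Its curvature is the determinant of these coefficients,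
    hence quadratic in [e]. *)
Lemma curvature_perturb (g : plane_curve) (f : R -> R) :
  smooth_curve g -> (forall t, det2 (g t) (Dcurve g t) = 1) -> smooth f ->
  let p := curvature g in
  exists r, smooth r /\ forall e t,
    curvature (perturb g (deformation g f) e) t =
    p t + e * (Derive (Derive (Derive f)) t / 2 + Derive p t * f t
               + 2 * p t * Derive f t) + e ^ 2 * r t.
Proof.
  intros hg hdet hf p.
  assert (hp : smooth p) by (apply smooth_curvature, hg).
  set (A := fun t => - (1 / 2) * Derive (Derive f) t - p t * f t).
  set (C := fun t => - (1 / 2) * Derive (Derive (Derive f)) t - Derive p t * f t
                     - 3 / 2 * (p t * Derive f t)).
  (* The coefficient of [e ^ 2] in the determinant with rows [(e A, 1 + e f'/2)] and
     [(- p + e C, - e p f)]. *)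
  exists (fun t => A t * (-1 * (p t * f t)) - 1 / 2 * Derive f t * C t). split.
  { unfold A, C. prove_smooth. }
  intros e t. destruct hg as [hx hy].
  assert (hode := centroaffine_ode g (conj hx hy) hdet).
  destruct (Derive_perturb p _ f e hp hx hf (fun s => proj1 (hode s)))
    as [hx1 hx2].
  destruct (Derive_perturb p _ f e hp hy hf (fun s => proj2 (hode s)))
    as [hy1 hy2].
  unfold curvature at 1. unfold det2. simpl.
  assert (h := hdet t). unfold det2 in h; simpl in h.
  cbv beta zeta in hx1, hx2, hy1, hy2.
  specialize (hx1 t); specialize (hx2 t); specialize (hy1 t); specialize (hy2 t).
  etransitivity.
  { apply f_equal2; apply f_equal2.
    - exact hx1.
    - exact hy2.
    - exact hy1.
    - exact hx2. }
  set (x0 := fst (g t)) in *; set (y0 := snd (g t)) in *.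
  set (x1 := Derive (fun s => fst (g s)) t) in *.
  set (y1 := Derive (fun s => snd (g s)) t) in *.
  unfold A, C.
  set (B := Derive f t). set (f2 := Derive (Derive f) t).
  set (f3 := Derive (Derive (Derive f)) t).
  (* Restoring the factor [[g, g'] = 1] makes the first equality a polynomial identity. *)
  transitivity ((p t + e * (f3 / 2 + Derive p t * f t + 2 * p t * B) + e * (e * 1) *
   ((- (1 / 2) * f2 - p t * f t) * (-1 * (p t * f t)) -
    1 / 2 * B * (- (1 / 2) * f3 - Derive p t * f t - 3 / 2 * (p t * B))))
    * (x0 * y1 - y0 * x1)); [field | rewrite h; ring].
Qed.

(** * The Euler-Lagrange equation *)

(* Testing extremality against the Euler-Lagrange expression itself, which is
   smooth and periodic, makes bump functions unnecessary. *)
Lemma euler_lagrange (a T : R) (g : plane_curve) :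
  a <> 0 -> 0 < T -> extremal a T g ->
  let p := curvature g in
  let F := fun t => Rpower (p t) (a - 1) in
  forall t, Derive (Derive (Derive F)) t =
            - 2 * F t * Derive p t - 4 * p t * Derive F t.
Proof.
  intros ha hT [[hg [hper [hdet hpos]]] hext] p F.
  assert (hp : smooth p) by (apply smooth_curvature, hg).
  assert (pp : periodic T p) by (apply periodic_curvature, hper).
  assert (hF : smooth F) by (apply smooth_Rpower; auto).
  assert (pF : periodic T F) by (intros t; unfold F; now rewrite pp).
  assert (hF1 := smooth_Derive _ hF). assert (hF2 := smooth_Derive _ hF1).
  assert (hF3 := smooth_Derive _ hF2). assert (hp1 := smooth_Derive _ hp).
  assert (pF1 := periodic_Derive _ _ pF). assert (pF2 := periodic_Derive _ _ pF1).
  (* The operator [L f = f'''/2 + p' f + 2 p f'] is skew-adjoint on periodic functions. With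
     [G = L F] and the variation [q = L G] below, the integral of [F q] is therefore minus that of
     [G * G]. *)
  set (G := fun t => 1 / 2 * Derive (Derive (Derive F)) t
                     + F t * Derive p t + 2 * (p t * Derive F t)).
  assert (hG : smooth G).
  { unfold G. prove_smooth. }
  assert (pG : periodic T G).
  { intros t; unfold G.
    rewrite (periodic_Derive _ _ pF2), pF, (periodic_Derive _ _ pp), pp, pF1.
    reflexivity. }
  assert (hG1 := smooth_Derive _ hG). assert (hG2 := smooth_Derive _ hG1).
  assert (hG3 := smooth_Derive _ hG2).
  assert (pG1 := periodic_Derive _ _ pG). assert (pG2 := periodic_Derive _ _ pG1).
  destruct (curvature_perturb g G hg hdet hG) as [r [hr hcurv]].
  fold p in hcurv.
  set (q := fun t => Derive (Derive (Derive G)) t / 2 + Derive p t * G t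
                     + 2 * p t * Derive G t) in hcurv.
  assert (hq : smooth q).
  { replace q with (fun t => 1 / 2 * Derive (Derive (Derive G)) t
      + Derive p t * G t + 2 * p t * Derive G t)
      by (apply functional_extensionality; intros; unfold q; field).
    prove_smooth. }
  assert (hvar : RInt (fun t => a * F t * q t) 0 T = 0).
  { transitivity (Derive (fun e => Bfun a T (perturb g (deformation g G) e)) 0);
      [symmetry | apply is_derive_unique, hext; assumption].
    apply is_derive_unique.
    apply is_derive_ext with
      (fun e => RInt (fun t => Rpower (p t + e * q t + e ^ 2 * r t) a) 0 T).
    - intros e. apply RInt_ext; intros t _. unfold q. rewrite hcurv; reflexivity.
    - apply (is_derive_RInt_Rpower a T p q r);
        [lra | | | | exact hpos]; intros s; apply smooth_continuous; assumption. }
  (* The boundary term of the integration by parts. *)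
  set (H := fun t => F t * Derive (Derive G) t / 2 - Derive F t * Derive G t / 2
                     + Derive (Derive F) t * G t / 2 + 2 * p t * F t * G t).
  assert (hH : forall t, is_derive H t (F t * q t + G t * G t)).
  { intros t. unfold H, q.
    change (G t * G t) with
      ((1 / 2 * Derive (Derive (Derive F)) t
        + F t * Derive p t + 2 * (p t * Derive F t)) * G t).
    clearbody G F p. clear - hF hF1 hF2 hG hG1 hG2 hp.
    apply (fun h => smooth_ex_derive _ h t) in hF, hF1, hF2, hG, hG1, hG2, hp.
    set (F1 := Derive F) in *; set (F2 := Derive F1) in *.
    set (G1 := Derive G) in *; set (G2 := Derive G1) in *.
    auto_derive; [repeat split; auto | ].
    change (Derive (fun t => F t) t) with (F1 t).
    change (Derive (fun t => G t) t) with (G1 t).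
    change (Derive (fun t => p t) t) with (Derive p t).
    change (Derive (fun t => F1 t) t) with (F2 t).
    change (Derive (fun t => G1 t) t) with (G2 t).
    change (Derive (fun t => F2 t) t) with (Derive F2 t).
    change (Derive (fun t => G2 t) t) with (Derive G2 t).
    field. }
  assert (hint : RInt (fun t => G t * G t) 0 T = 0).
  { assert (i1 : is_RInt (fun t => F t * q t + G t * G t) 0 T (H T - H 0)).
    { apply (is_RInt_derive H); intros t _; [apply hH | ].
      apply smooth_continuous; prove_smooth. }
    assert (i2 : is_RInt (fun t => a * F t * q t) 0 T 0).
    { rewrite <- hvar at 2. apply (@RInt_correct R_CompleteNormedModule).
      apply (@ex_RInt_continuous R_CompleteNormedModule); intros t _.
      apply smooth_continuous; prove_smooth. }
    assert (H0 : H T - H 0 = 0).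
    { unfold H. rewrite <- (Rplus_0_l T).
      rewrite pF, pG2, pF1, pG1, pF2, pG, pp. ring. }
    (* Dividing the vanishing variation by [a] and subtracting it leaves the integral of [G * G];
       this is where [a <> 0] enters. *)
    rewrite H0 in i1. apply (is_RInt_scal _ _ _ (/ a)) in i2.
    apply (is_RInt_minus _ _ _ _ _ _ i1) in i2.
    assert (z : 0 - / a * 0 = 0) by ring.
    refine (eq_trans _ z).
    apply is_RInt_unique. eapply is_RInt_ext; [ | exact i2].
    intros t _. unfold minus, plus, opp, scal; simpl. unfold mult; simpl.
    field; auto. }
  assert (hG0 := periodic_nonneg_RInt_zero T (fun t => G t * G t) hT).
  intros t.
  assert (hGt : G t * G t = 0).
  { apply hG0; auto.
    - intros s; now rewrite pG.
    - intros s; apply smooth_continuous; prove_smooth.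
    - intros s; nra. }
  apply Rmult_integral in hGt. unfold G in hGt. destruct hGt; lra.
Qed.

(** * Curves of constant curvature *)

(** [acos x] covers the upper half circle, since its sine is [|y|]; negating the angle covers the
    lower half. *)
Lemma unit_circle_angle (x y : R) :
  x ^ 2 + y ^ 2 = 1 -> exists theta, cos theta = x /\ sin theta = y.
Proof.
  intros h.
  assert (hx : -1 <= x <= 1) by nra.
  assert (hy : 1 - x² = y²) by (unfold Rsqr; lra).
  destruct (Rle_dec 0 y) as [y_nonneg | y_neg].
  - exists (acos x). rewrite cos_acos, sin_acos, hy by assumption.
    split; [reflexivity | apply sqrt_Rsqr, y_nonneg].
  - exists (- acos x). rewrite cos_neg, sin_neg, cos_acos, sin_acos, hy
      by assumption.
    split; [reflexivity | ].
    rewrite (Rsqr_neg y), sqrt_Rsqr; lra.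
Qed.

Lemma harmonic_solution (w : R) (x : R -> R) :
  w <> 0 -> smooth x -> (forall t, Derive (Derive x) t = - w ^ 2 * x t) ->
  forall t, x t = cos (w * t) * x 0 + sin (w * t) / w * Derive x 0.
Proof.
  intros hw hx hode t.
  assert (hx' := smooth_ex_derive _ hx).
  assert (hx1' := smooth_ex_derive _ (smooth_Derive _ hx)).
  set (x1 := Derive x) in *.
  (* The inverse rotation of [(x, x'/w)] by the angle [w t] is constant. *)
  assert (hu := Derive_zero_const
                  (fun t => x t * cos (w * t) - x1 t / w * sin (w * t))).
  assert (hv := Derive_zero_const
                  (fun t => x t * sin (w * t) + x1 t / w * cos (w * t))).
  assert (hu0 : forall t, is_derive
                  (fun t => x t * cos (w * t) - x1 t / w * sin (w * t)) t 0).
  { intros s. auto_derive; [repeat split; auto | ].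
    change (Derive (fun t => x t) s) with (x1 s).
    change (Derive (fun t => x1 t) s) with (Derive x1 s).
    rewrite hode. field; auto. }
  assert (hv0 : forall t, is_derive
                  (fun t => x t * sin (w * t) + x1 t / w * cos (w * t)) t 0).
  { intros s. auto_derive; [repeat split; auto | ].
    change (Derive (fun t => x t) s) with (x1 s).
    change (Derive (fun t => x1 t) s) with (Derive x1 s).
    rewrite hode. field; auto. }
  specialize (hu hu0 t 0); specialize (hv hv0 t 0); cbv beta in hu, hv.
  rewrite Rmult_0_r, cos_0, sin_0 in hu, hv.
  assert (h := sin2_cos2 (w * t)); unfold Rsqr in h.
  (* Rotating the constant vector forward again recovers [x t]. *)
  replace (x 0) with (x t * cos (w * t) - x1 t / w * sin (w * t)) by lra.
  replace (sin (w * t) / w * x1 0) with (sin (w * t) * (x1 0 / w))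
    by (field; auto).
  replace (x1 0 / w) with (x t * sin (w * t) + x1 t / w * cos (w * t)) by lra.
  transitivity (x t * (sin (w * t) * sin (w * t) + cos (w * t) * cos (w * t)));
    [rewrite h; ring | ring].
Qed.

Lemma constant_curvature_conic (c : R) (g : plane_curve) :
  0 < c -> smooth_curve g -> (forall t, det2 (g t) (Dcurve g t) = 1) ->
  (forall t, curvature g t = c) -> is_conic (trace g).
Proof.
  intros hc [hx hy] hdet hcurv.
  assert (hode := centroaffine_ode g (conj hx hy) hdet).
  assert (hw : 0 < sqrt c) by (apply sqrt_lt_R0, hc).
  assert (hw2 : sqrt c ^ 2 = c) by (apply pow2_sqrt; lra).
  set (w := sqrt c) in *.
  assert (solx := harmonic_solution w _ (Rgt_not_eq _ _ hw) hx).
  assert (soly := harmonic_solution w _ (Rgt_not_eq _ _ hw) hy).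
  assert (e := hdet 0). unfold det2, Dcurve in e; simpl in e.
  cbv beta in solx, soly.
  set (x0 := fst (g 0)) in *. set (y0 := snd (g 0)) in *.
  set (x1 := Derive (fun s => fst (g s)) 0) in *.
  set (y1 := Derive (fun s => snd (g s)) 0) in *.
  assert (solx' : forall t, fst (g t) = cos (w * t) * x0 + sin (w * t) / w * x1).
  { apply solx; intros t. rewrite hw2, <- (hcurv t). apply hode. }
  assert (soly' : forall t, snd (g t) = cos (w * t) * y0 + sin (w * t) / w * y1).
  { apply soly; intros t. rewrite hw2, <- (hcurv t). apply hode. }
  clear solx soly.
  (* The equation [[q, g'(0)]^2 + c [g(0), q]^2 = 1] in the point [q]. *)
  exists (y1 ^ 2 + c * y0 ^ 2), (- (x1 * y1 + c * x0 * y0)),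
    (x1 ^ 2 + c * x0 ^ 2), 0, 0, (-1).
  split.
  - apply Rlt_not_eq.
    (* The determinant is [- c * [g(0), g'(0)] ^ 2 = - c]. *)
    replace (_ + _) with (- c * (x0 * y1 - y0 * x1) ^ 2) by ring.
    rewrite e. lra.
  - intros x y.
    assert (conic_eq : forall x y,
      (y1 ^ 2 + c * y0 ^ 2) * x ^ 2 + 2 * - (x1 * y1 + c * x0 * y0) * x * y +
      (x1 ^ 2 + c * x0 ^ 2) * y ^ 2 + 2 * 0 * x + 2 * 0 * y + -1
      = (x * y1 - y * x1) ^ 2 + (w * (x0 * y - y0 * x)) ^ 2 - 1)
      by (intros; rewrite <- hw2; ring).
    rewrite conic_eq. split.
    + intros [t ht].
      assert (ex : x = cos (w * t) * x0 + sin (w * t) / w * x1)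
        by (rewrite <- solx', ht; reflexivity).
      assert (ey : y = cos (w * t) * y0 + sin (w * t) / w * y1)
        by (rewrite <- soly', ht; reflexivity).
      (* The coordinates [[q, g'(0)]] and [w * [g(0), q]] of the point [q = g t] are the cosine and
         sine of [w * t]. *)
      replace (x * y1 - y * x1) with (cos (w * t) * (x0 * y1 - y0 * x1))
        by (rewrite ex, ey; ring).
      replace (w * (x0 * y - y0 * x)) with (sin (w * t) * (x0 * y1 - y0 * x1))
        by (rewrite ex, ey; field; lra).
      rewrite e. generalize (sin2_cos2 (w * t)); unfold Rsqr; lra.
    + intros h.
      destruct (unit_circle_angle (x * y1 - y * x1) (w * (x0 * y - y0 * x)))
        as [theta [hcos hsin]]; [lra | ].
      (* The curve is defined on the whole line, so every angle is reached and the trace is the full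
         ellipse. *)
      exists (theta / w).
      rewrite (surjective_pairing (g (theta / w))), solx', soly'.
      replace (w * (theta / w)) with theta by (field; lra).
      rewrite hcos, hsin. f_equal.
      * transitivity (x * (x0 * y1 - y0 * x1)); [field; lra | rewrite e; ring].
      * transitivity (y * (x0 * y1 - y0 * x1)); [field; lra | rewrite e; ring].
Qed.

(** * The equation for F and the exponents 1 and 1/2 *)

Theorem proposition3p7 (a T : R) (gamma : plane_curve)
  (ha : a <> 0) (hT : 0 < T) (hgamma : extremal a T gamma) :
  (a <> 1 ->
    let b := 1 / (a - 1) in
    let F := fun t => Rpower (curvature gamma t) (a - 1) in
    forall t : R,
      is_derive_n F 3 t (- 2 * (2 + b) * Rpower (F t) b * Derive F t)) /\
  (a = 1 \/ a = 1 / 2 ->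
    (exists c : R, forall t : R, curvature gamma t = c) /\
    is_conic (trace gamma)).
Proof.
  assert (hEL := euler_lagrange a T gamma ha hT hgamma).
  cbv zeta in hEL.
  destruct hgamma as [[hg [hper [hdet hpos]]] _].
  assert (hp := smooth_curvature _ hg).
  assert (pp := periodic_curvature _ _ hper).
  set (p := curvature gamma) in *.
  set (F := fun t => Rpower (p t) (a - 1)) in *.
  assert (hF : smooth F) by (apply smooth_Rpower; auto).
  assert (pF : periodic T F) by (intros t; unfold F; now rewrite pp).
  assert (Fb : a <> 1 -> forall t, Rpower (F t) (1 / (a - 1)) = p t).
  { intros ha1 t. unfold F. rewrite Rpower_mult.
    replace ((a - 1) * (1 / (a - 1))) with 1 by (field; lra).
    apply Rpower_1, hpos. }
  assert (ode : a <> 1 -> forall t, is_derive (Derive (Derive F)) t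
    (- 2 * (2 + 1 / (a - 1)) * Rpower (F t) (1 / (a - 1)) * Derive F t)).
  { intros ha1 t. rewrite Fb by assumption.
    eapply is_derive_eq; [apply smooth_is_derive; prove_smooth | ].
    rewrite hEL.
    assert (dF : Derive F t = (a - 1) * Rpower (p t) (a - 1 - 1) * Derive p t).
    { apply is_derive_unique, is_derive_Rpower; [auto | ].
      apply smooth_is_derive, hp. }
    (* Writing [p ^ (a - 1)] as [p ^ (a - 2) * p] exhibits [F p'] as [p F' / (a - 1)]. *)
    rewrite dF. unfold F. rewrite <- (Rpower_pred_mult (p t) (a - 1)) by auto.
    field; lra. }
  split; [exact ode | intros ha'].
  assert (hconst : exists c, forall t, p t = c).
  { exists (p 0); intros t. destruct ha' as [ha1 | ha2].
    - apply Derive_zero_const; clear t; intros t.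
      (* For [a = 1] the exponent of [F] is zero, so the Euler-Lagrange equation reduces to
         [0 = - 2 p']. *)
      assert (F1 : forall s, F s = 1).
      { intros s. unfold F. rewrite ha1, Rminus_diag. apply Rpower_O, hpos. }
      assert (DF : Derive F = fun _ => 0).
      { apply functional_extensionality; intros s.
        rewrite (Derive_ext F (fun _ => 1)) by assumption. apply Derive_const. }
      assert (DDF : Derive (fun _ => 0) = fun _ => 0).
      { apply functional_extensionality; intros s. apply Derive_const. }
      specialize (hEL t). rewrite DF, !DDF, F1 in hEL.
      eapply is_derive_eq; [apply smooth_is_derive, hp | lra].
    - assert (ha1 : a <> 1) by lra.
      assert (D3 : forall s, is_derive (Derive (Derive F)) s 0).
      { intros s. eapply is_derive_eq; [apply ode, ha1 | ].
        (* At [a = 1 / 2] the exponent [b] is [-2], so the factor [2 + b] vanishes. *)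
        replace (2 + 1 / (a - 1)) with 0 by (rewrite ha2; field). ring. }
      assert (pF1 := periodic_Derive _ _ pF).
      (* Descend twice: [F''] is constant and [F'] periodic, so [F'' = 0]; then [F'] is constant and
         [F] periodic, so [F' = 0]. Since [p] is a power of [F], it is constant too. *)
      assert (D2 : forall s, is_derive (Derive F) s (Derive (Derive F) 0)).
      { intros s. rewrite (Derive_zero_const _ D3 0 s).
        apply smooth_is_derive; prove_smooth. }
      rewrite (periodic_Derive_const T _ _ hT pF1 D2) in D2.
      assert (D1 : forall s, is_derive F s (Derive F 0)).
      { intros s. rewrite (Derive_zero_const _ D2 0 s).
        apply smooth_is_derive; prove_smooth. }
      rewrite (periodic_Derive_const T _ _ hT pF D1) in D1.
      rewrite <- (Fb ha1 t), <- (Fb ha1 0), (Derive_zero_const _ D1 t 0).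
      reflexivity. }
  split; [exact hconst | ].
  destruct hconst as [c hc].
  apply (constant_curvature_conic c); auto.
  rewrite <- (hc 0). apply hpos.
Qed.
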